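(* Let $\mathfrak g$ be a Malcev algebra, $(M,\rho)$ a representation of $\mathfrak g$, and $T:M\to\mathfrak g$ an embedding tensor operator. Then $M$ with the bilinear bracket $$[m,n]_M:=\rho(T(m))(n),\qquad m,n\in M,$$ is a left Malcev dialgebra.
   Context: All vector spaces and linear maps are over a fixed field of characteristic $0$. A Malcev algebra is a vector space $\mathfrak g$ with a skew-symmetric bilinear bracket $[\cdot,\cdot]:\mathfrak g\times\mathfrak g\to\mathfrak g$ satisfying $J(x,y,[x,z])=[J(x,y,z),x]$ for all $x,y,z\in\mathfrak g$, where $J(x,y,z)=[[x,y],z]+[[y,z],x]+[[z,x],y]$. A representation of $\mathfrak g$ on a vector space $M$ is a linear map $\rho:\mathfrak g\to\operatorname{End}(M)$ such that for all $x,y,z\in\mathfrak g$ $$\rho([[x,y],z])=\rho(x)\rho(y)\rho(z)-\rho(z)\rho(x)\rho(y)+\rho(y)\rho([z,x])-\rho([y,z])\rho(x).$$ An embedding tensor operator is a linear map $T:M\to\mathfrak g$ with $[T(m),T(n)]=T(\rho(T(m))(n))$ for all $m,n\in M$; then $(M,\mathfrak g,T)$ is called an embedding tensor on the Malcev algebra $\mathfrak g$. A left Malcev dialgebra is a vector space $A$ with a bilinear bracket $[\cdot,\cdot]:A\times A\to A$ (not necessarily skew-symmetric) such that for all $x,y,z,t\in A$ $$[[x,y]+[y,x],z]=0,$$ $$[x,[y,[z,t]]]=[y,[z,[x,t]]]+[z,[[x,y],t]]+[[x,z],[y,t]]+[[x,[y,z]],t].$$ *)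

(* Defs.v *)
From mathcomp Require Import all_boot all_algebra.

Set Implicit Arguments.
Unset Strict Implicit.
Unset Printing Implicit Defensive.

Import GRing.Theory.
Local Open Scope ring_scope.

Section MalcevDefinitions.
Variable K : fieldType.

(* Algebra structures are predicates on a bracket [br], and vector spaces are
   arbitrary (possibly infinite-dimensional) K-modules. *)

Definition jacobian (g : lmodType K) (br : g -> g -> g) (x y z : g) : g :=
  br (br x y) z + br (br y z) x + br (br z x) y.

Definition malcev_algebra (g : lmodType K) (br : g -> g -> g) : Prop :=
  [/\ bilinear_for *:%R *:%R br,
      forall x y, br x y = - br y x
    & forall x y z,
        jacobian br x y (br x z) = br (jacobian br x y z) x].

(* MathComp has no module structure on {linear M -> M} for a general lmodType,
   so a linear map g -> End(M) is given in curried form: bilinearity of [rho]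
   says that every [rho x] is linear and that [rho] is linear in x. Equality
   in End(M) is equality at every m : M. *)
Definition malcev_representation (g : lmodType K) (br : g -> g -> g)
    (M : lmodType K) (rho : g -> M -> M) : Prop :=
  bilinear_for *:%R *:%R rho /\
  forall (x y z : g) (m : M),
    rho (br (br x y) z) m =
      rho x (rho y (rho z m)) - rho z (rho x (rho y m))
      + rho y (rho (br z x) m) - rho (br y z) (rho x m).

Definition embedding_tensor_operator (g : lmodType K) (br : g -> g -> g)
    (M : lmodType K) (rho : g -> M -> M) (T : M -> g) : Prop :=
  linear T /\ forall m n : M, br (T m) (T n) = T (rho (T m) n).

Definition left_malcev_dialgebra (A : lmodType K) (br : A -> A -> A) : Prop :=
  [/\ bilinear_for *:%R *:%R br,
      forall x y z, br (br x y + br y x) z = 0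
    & forall x y z t,
        br x (br y (br z t)) =
          br y (br z (br x t)) + br z (br (br x y) t)
          + br (br x z) (br y t) + br (br x (br y z)) t].

End MalcevDefinitions.

(* Main.v *)
Require Import Defs.
From mathcomp Require Import all_boot all_algebra.

Set Implicit Arguments.
Unset Strict Implicit.
Unset Printing Implicit Defensive.

Import GRing.Theory.
Local Open Scope ring_scope.

(** The operator [T] turns the bracket [rho (T m) n] of [M] into the bracket of
    [g], so both dialgebra identities become identities between the operators
    [rho X], where [X], [Y], [Z] are the images under [T] of the first three
    arguments. The first one holds because symmetric sums vanish in [g]. The
    second one is the representation axiom at [(Y, Z, X)], with
    [[Y, Z], X] = - [X, [Y, Z]] and [Z, X] = - [X, Z], solved for
    [rho X \o rho Y \o rho Z]. *)

Theorem proposition2p8 (K : fieldType) (charK : [pchar K] =i pred0)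
    (g : lmodType K) (br : g -> g -> g) (hg : malcev_algebra br)
    (M : lmodType K) (rho : g -> M -> M)
    (hrho : malcev_representation br rho)
    (T : M -> g) (hT : embedding_tensor_operator br rho T) :
  left_malcev_dialgebra (fun m n : M => rho (T m) n).
Proof.
case: hg hrho hT => _ brC _ [[rhoPl rhoPr] rhoP] [Tlin TM].
have TD u v : T (u + v) = T u + T v by have := Tlin 1 u v; rewrite !scale1r.
have rho0 m : rho 0 m = 0.
  by have := rhoPl m (-1) 0 0; rewrite /= scaler0 addr0 scaleN1r addNr.
have rhoN x m : rho (- x) m = - rho x m.
  by have := rhoPl m (-1) x 0; rewrite /= rho0 !addr0 !scaleN1r.
split.
- split; last by move=> m; apply: rhoPr.
  by move=> n a u v /=; rewrite Tlin; apply: rhoPl.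
- by move=> x y z; rewrite TD -!TM [br (T y) _]brC subrr rho0.
move=> x y z t; rewrite -!TM [br (T x) (br _ _)]brC rhoN rhoP.
rewrite [br (T z) (T x)]brC rhoN.
(* Only cancellation in the abelian group M remains. *)
set P := rho (T y) (rho (T z) (rho (T x) t)).
set Q := rho (T z) (rho (br _ _) t).
set W := rho (T x) _.
rewrite opprK !opprD opprK addrACA -!addrA subrr addr0.
by rewrite (addrCA Q) addNKr [RHS]addrC subrK.
Qed.
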